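(* Let $C_1$ and $C_2$ be two nonempty, closed and convex subsets of a real Hilbert space $(H, \langle \cdot, \cdot \rangle)$ with induced norm $| \cdot |$, and let $P_1 : H \to C_1$ and $P_2 : H \to C_2$ be the corresponding nearest point projections of $H$ onto $C_1$ and $C_2$, respectively. Let $x_0 \in H$ be arbitrary and let the sequence $\{x_n : n \in \mathbb{N}\}$ be defined by $x_{2n+1} = P_1 x_{2n}$ and $x_{2n+2} = P_2 x_{2n+1}$ for all $n \in \mathbb{N}$. Then $$\lim_{n \rightarrow \infty}(x_{2n+2} - x_{2n+1}) = \lim_{n \rightarrow \infty}(x_{2n} - x_{2n+1}) = v,$$ where $v$ is the point of least norm in the closure of $C_2 - C_1$ and the convergence is in norm.
   Context: $\mathbb{N} = \{0, 1, 2, \dots\}$ denotes the set of nonnegative integers. For a nonempty, closed and convex subset $C$ of $H$, the nearest point projection of $H$ onto $C$ maps each $x \in H$ to the unique point of $C$ closest to $x$ in the norm $|\cdot|$. Here $C_2 - C_1 = \{y - x : y \in C_2,\ x \in C_1\}$, and its closure is taken in the norm topology of $H$; this closure is a nonempty, closed and convex set, so it has a unique point of least norm. *)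

(* Defs.v *)
From mathcomp Require Import all_boot all_order all_algebra.
From mathcomp Require Import all_classical all_reals all_analysis.

Set Implicit Arguments.
Unset Strict Implicit.
Unset Printing Implicit Defensive.

Import Order.TTheory GRing.Theory Num.Theory.
Import numFieldNormedType.Exports.

Local Open Scope classical_set_scope.
Local Open Scope ring_scope.

(* [get] selects an element of the set of minimizers.  In a Hilbert space this
   set is a singleton as soon as [C] (resp. [A]) is nonempty, closed and convex,
   so the value is then the unique minimizer; it is a default value if there is
   no minimizer. *)
Definition nearest_point (R : realType) (H : normedModType R)
    (C : set H) (x : H) : H :=
  get [set p | C p /\ forall y, C y -> `|x - p| <= `|x - y|].

Definition least_norm_point (R : realType) (H : normedModType R)
    (A : set H) : H :=
  get [set p | A p /\ forall y, A y -> `|p| <= `|y|].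

Definition minkowski_diff (R : realType) (H : normedModType R) (A B : set H) : set H :=
  [set y - x | y in A & x in B].

(* Main.v *)
Require Import Defs.
From mathcomp Require Import all_boot all_order all_algebra.
From mathcomp Require Import all_classical all_reals all_analysis.
From mathcomp Require Import ring lra.

(** Write a n for the even terms and b n for the odd ones, so that b n is the
    projection of a n on C1 and a n.+1 the projection of b n on C2.  Everything
    follows from the obtuse angle inequality satisfied by the projection p of x
    on a convex set, <x - p, y - p> <= 0 for y in the set.

    For c1 in C1 and c2 in C2 it yields two estimates: the projection on C2
    satisfies (lemma [pythagoras_projection])
      |c2 - a n.+1|^2 + |a n.+1 - b n|^2 <= |c2 - b n|^2,
    and the projection on C1 satisfies (lemma [four_point])
      |c2 - b n|^2 <= |c2 - c1|^2 + |c2 - a n|^2.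
    Added together they bound |a n.+1 - b n|^2 - |c2 - c1|^2 by the telescoping
    difference |c2 - a n|^2 - |c2 - a n.+1|^2.  As |a n.+1 - b n| does not
    increase with n, summation gives
      |a n.+1 - b n|^2 <= |c2 - c1|^2 + |c2 - a 0|^2 / (n + 1)
    (lemma [alternating_projections_rate]).  Since c1 and c2 are arbitrary,
    |a n.+1 - b n| tends to the distance between C1 and C2, which is |v|, and
    so does |a n.+1 - b n.+1|, which lies in between.

    The differences a n.+1 - b n and a n.+1 - b n.+1 lie in the closed convex
    set closure (C2 - C1) and are minimizing for the norm; the obtuse angle
    inequality, now for the projection v of 0 on that set, turns convergence
    of the norms into convergence to v (lemma [cvg_least_norm]). *)

Set Implicit Arguments.
Unset Strict Implicit.
Unset Printing Implicit Defensive.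

Import Order.TTheory GRing.Theory Num.Theory.
Import numFieldNormedType.Exports.

Local Open Scope classical_set_scope.
Local Open Scope ring_scope.

(** * Convex sets *)

Lemma convex_segment (R : realType) (V : lmodType R) (C : set V) (x y : V)
    (t : R) :
  convex_set C -> C x -> C y -> 0 <= t -> t <= 1 -> C (x + t *: (y - x)).
Proof.
move=> cC Cx Cy t0 t1.
have := cC y x (Itv01 t0 t1); rewrite !inE => /(_ Cy Cx).
rewrite /conv/= => CC.
suff -> : x + t *: (y - x) = t *: y + (1 - t) *: x by [].
by rewrite scalerBr scalerBl scale1r addrCA.
Qed.

Lemma convex_minkowski_diff (R : realType) (H : normedModType R)
    (A B : set H) :
  convex_set A -> convex_set B -> convex_set (minkowski_diff A B).
Proof.
move=> cA cB _ _ l /set_mem[a Aa [b Bb <-]] /set_mem[a' Aa' [b' Bb' <-]].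
apply/mem_set; exists (l%:num *: a + (1 - l%:num) *: a').
  by apply/set_mem/cA; exact/mem_set.
exists (l%:num *: b + (1 - l%:num) *: b').
  by apply/set_mem/cB; exact/mem_set.
by rewrite /conv/= !scalerBr opprD addrACA.
Qed.

Lemma closure_distP (R : realType) (H : normedModType R) (A : set H) (p : H) :
  closure A p <-> forall e : R, 0 < e -> exists2 a, A a & `|p - a| < e.
Proof.
split=> [clp e e0|dp B /nbhs_ballP[e /= e0 peB]].
  have [a [Aa]] := clp _ (nbhsx_ballx p e e0).
  by rewrite -ball_normE /=; exists a.
have [a Aa pa] := dp e e0; exists a; split=> //; apply: peB.
by rewrite -ball_normE.
Qed.

Lemma convex_closure (R : realType) (H : normedModType R) (A : set H) :
  convex_set A -> convex_set (closure A).
Proof.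
move=> cA p q l /set_mem/closure_distP clp /set_mem/closure_distP clq.
apply/mem_set/closure_distP => e e0.
have [a Aa pa] := clp e e0; have [b Ab qb] := clq e e0.
exists (l%:num *: a + (1 - l%:num) *: b).
  by apply/set_mem/cA; exact/mem_set.
rewrite /conv/= opprD addrACA -!scalerBr.
have l0 : 0 <= l%:num by [].
have l1 : 0 <= 1 - l%:num by rewrite subr_ge0.
set M := Num.max `|p - a| `|q - b|.
apply: (@le_lt_trans _ _ M); last by rewrite gt_max pa.
rewrite (le_trans (ler_normD _ _))// !normrZ (ger0_norm l0) (ger0_norm l1).
have pM : `|p - a| <= M by rewrite le_max lexx.
have qM : `|q - b| <= M by rewrite le_max lexx orbT.
by have := ler_wpM2l l0 pM; have := ler_wpM2l l1 qM; lra.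
Qed.

(** * A rate for telescoping bounds *)

(** Summing the third hypothesis up to n bounds the sum of the s k - m by t 0;
    each of these n + 1 terms is at least s n - m. *)
Lemma telescoping_rate (R : realType) (s t : nat -> R) (m : R) :
  (forall n, s n.+1 <= s n) -> (forall n, 0 <= t n) ->
  (forall n, s n - m <= t n - t n.+1) ->
  forall n, s n <= m + t 0%N / n.+1%:R.
Proof.
move=> s_noninc t_ge0 st n.
have key : n.+1%:R * (s n - m) <= t 0%N - t n.+1.
  elim: n => [|n IH]; first by rewrite mul1r.
  have := ler_wpM2l (ler0n R n.+1) (s_noninc n).
  by have := st n.+1; rewrite -[n.+2]addn1 natrD; lra.
rewrite -lerBlDl ler_pdivlMr ?ltr0Sn// mulrC (le_trans key)//.
by rewrite gerBl.
Qed.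

(** * Projections in an inner product space *)

Section inner_product.
Context (R : realType) (H : normedModType R) (dot : {dot H for @idfun R}).
Hypothesis norm_dot : forall u : H, `|u| = Num.sqrt (dot u u).
Implicit Types (u v w : H).

Lemma dotC u v : dot u v = dot v u.
Proof. by have := hermC dot u v; rewrite expr0 mul1r. Qed.

Lemma dotDr u v w : dot u (v + w) = dot u v + dot u w.
Proof. exact: linearDr. Qed.

Lemma dotNr u v : dot u (- v) = - dot u v.
Proof. exact: linearNr. Qed.

Lemma dotZr (t : R) u v : dot u (t *: v) = t * dot u v.
Proof. by rewrite linearZr. Qed.

Lemma sqr_normE u : `|u| ^+ 2 = dot u u.
Proof.
rewrite norm_dot sqr_sqrtr//.
have [->|u0] := eqVneq u 0; first by rewrite linear0l.
exact/ltW/neq0_dnorm_gt0.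
Qed.

Lemma sqr_normD u v : `|u + v| ^+ 2 = `|u| ^+ 2 + 2 * dot u v + `|v| ^+ 2.
Proof. by rewrite !sqr_normE linearDl !linearDr /= (dotC v u); ring. Qed.

Lemma parallelogram u v :
  `|u + v| ^+ 2 + `|u - v| ^+ 2 = 2 * `|u| ^+ 2 + 2 * `|v| ^+ 2.
Proof. by rewrite !sqr_normD dotNr normrN; ring. Qed.

(** Moving from p towards y by a small fraction t changes the squared distance
    to x by - 2 t <x - p, y - p> + t^2 |y - p|^2, which minimality of p forces
    to be nonnegative. *)
Lemma projection_obtuse (C : set H) (x p y : H) :
  convex_set C -> C p -> (forall z, C z -> `|x - p| <= `|x - z|) -> C y ->
  dot (x - p) (y - p) <= 0.
Proof.
move=> cC Cp p_min Cy; rewrite leNgt; apply/negP => d_gt0.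
set d := dot _ _ in d_gt0; set N := `|y - p| ^+ 2.
have N_ge0 : 0 <= N by exact: sqr_ge0.
have dN_gt0 : 0 < d + N by lra.
(* If d > 0, the squared distance decreases for every t > 0 with t N < 2 d;
   this t satisfies t N < d and is at most 1, whether or not N = 0. *)
pose t := d / (d + N).
have t_gt0 : 0 < t by rewrite divr_gt0.
have t_le1 : t <= 1 by rewrite ler_pdivrMr// mul1r lerDl.
have tE : t * (d + N) = d by rewrite divfK// gt_eqF.
have := p_min _ (convex_segment cC Cp Cy (ltW t_gt0) t_le1).
rewrite -ler_sqr ?nnegrE// opprD addrA [X in _ <= X]sqr_normD normrN dotNr dotZr.
rewrite normrZ exprMn (ger0_norm (ltW t_gt0)) -/d -/N => d_le.
have tN : t * N = d - t * d by lra.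
have := mulr_gt0 t_gt0 (addr_gt0 d_gt0 (mulr_gt0 t_gt0 d_gt0)).
have : t ^+ 2 * N = t * (d - t * d) by rewrite -tN; ring.
lra.
Qed.

Lemma pythagoras_projection (C : set H) (x p y : H) :
  convex_set C -> C p -> (forall z, C z -> `|x - p| <= `|x - z|) -> C y ->
  `|x - p| ^+ 2 + `|p - y| ^+ 2 <= `|x - y| ^+ 2.
Proof.
move=> cC Cp p_min Cy.
have obtuse := projection_obtuse cC Cp p_min Cy.
rewrite -(subrKA p x (- y)) [X in _ <= X]sqr_normD -(opprB y p) dotNr; lra.
Qed.

(** With u := z - p, q := y - p and r := x - p, the right-hand side minus the
    left-hand side is |u - q - r|^2 - 2 <r, q>, and <r, q> <= 0 by the obtuse
    angle inequality. *)
Lemma four_point (C : set H) (x p y z : H) :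
  convex_set C -> C p -> (forall z, C z -> `|x - p| <= `|x - z|) -> C y ->
  `|z - p| ^+ 2 <= `|z - y| ^+ 2 + `|z - x| ^+ 2.
Proof.
move=> cC Cp p_min Cy.
have := projection_obtuse cC Cp p_min Cy.
rewrite -(subrKA p z (- y)) -(subrKA p z (- x)) -(opprB y p) -(opprB x p).
move: (z - p) (y - p) (x - p) => u q r rq.
have := sqr_ge0 `|u - q - r|.
rewrite !sqr_normD !normrN !dotNr (dotC (u - q)) dotDr dotNr (dotC r u).
lra.
Qed.

(** The least-norm point v is the projection of 0 on B, so that Pythagoras'
    inequality reads |v - w|^2 <= |w|^2 - |v|^2 for w in B. *)
Lemma cvg_least_norm (B : set H) (v : H) (w : nat -> H) :
  convex_set B -> B v -> (forall y, B y -> `|v| <= `|y|) ->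
  (forall n, B (w n)) -> `|w n| @[n --> \oo] --> `|v| ->
  w n @[n --> \oo] --> v.
Proof.
move=> cB Bv v_min Bw wv.
have dist_le n : `|v - w n| ^+ 2 <= `|w n| ^+ 2 - `|v| ^+ 2.
  have v_min0 z : B z -> `|0 - v| <= `|0 - z|.
    by move=> /v_min; rewrite !sub0r !normrN.
  have := pythagoras_projection cB Bv v_min0 (Bw n).
  by rewrite !sub0r !normrN; lra.
have sqr_cvg0 : `|w n| ^+ 2 - `|v| ^+ 2 @[n --> \oo] --> (0 : R).
  rewrite -(subrr (`|v| ^+ 2)); apply: cvgB; last exact: cvg_cst.
  by under eq_fun do rewrite expr2; rewrite expr2; exact: cvgM.
apply/cvgrPdist_lt => e e0.
have : \forall n \near \oo, `|w n| ^+ 2 - `|v| ^+ 2 < e ^+ 2.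
  exact: cvgr_lt sqr_cvg0 _ (exprn_gt0 2 e0).
apply: filterS => n wn; rewrite -ltr_sqr ?nnegrE ?(ltW e0)//.
exact: le_lt_trans (dist_le n) wn.
Qed.

End inner_product.

(** * Existence of projections *)

Section projection_existence.
Context (R : realType) (H : completeNormedModType R).
Context (dot : {dot H for @idfun R}).
Hypothesis norm_dot : forall u : H, `|u| = Num.sqrt (dot u u).

(** A minimizing sequence is Cauchy: by the parallelogram law two nearly optimal
    points of C are close to each other, since their midpoint is in C and thus
    cannot be much closer to x than they are. *)
Lemma projection_exists (C : set H) (x : H) :
  C !=set0 -> closed C -> convex_set C ->
  exists p, C p /\ forall y, C y -> `|x - p| <= `|x - y|.
Proof.
move=> [c Cc] clC cC.
pose E := [set `|x - y| ^+ 2 | y in C].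
have E0 : lbound E 0 by move=> _ [y _ <-]; exact: sqr_ge0.
have infE : has_inf E by split; [exists (`|x - c| ^+ 2), c|exists 0].
pose D := inf E.
have D_le y : C y -> D <= `|x - y| ^+ 2.
  by move=> Cy; apply: ge_inf; [exists 0|exists y].
have [y yP] : {y : nat -> H &
    forall n, C (y n) /\ `|x - y n| ^+ 2 < D + n.+1%:R^-1}.
  apply: (@choice _ _ (fun n z => C z /\ `|x - z| ^+ 2 < D + n.+1%:R^-1)) => n.
  have n_gt0 : 0 < n.+1%:R^-1 :> R by rewrite invr_gt0.
  by have [_ [z Cz <-] zD] := inf_adherent n_gt0 infE; exists z.
have near_min e u w : C u -> C w -> `|x - u| ^+ 2 < D + e ->
    `|x - w| ^+ 2 < D + e -> `|u - w| ^+ 2 < 4 * e.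
  move=> Cu Cw uD wD.
  have half0 : 0 <= 2^-1 :> R by rewrite invr_ge0.
  have half1 : 2^-1 <= 1 :> R by rewrite invf_le1// ler1n.
  have := D_le _ (convex_segment cC Cu Cw half0 half1).
  set m := u + 2^-1 *: (w - u) => Dm.
  have m2 : 2 *: m = u + w.
    rewrite /m scalerDr scalerA mulfV// scale1r scaler_nat mulr2n -addrA.
    by rewrite subrKC.
  have xm : (x - u) + (x - w) = 2 *: (x - m).
    by rewrite scalerBr m2 scaler_nat mulr2n opprD addrACA.
  have := parallelogram norm_dot (x - u) (x - w).
  have -> : (x - u) - (x - w) = w - u by rewrite opprB addrC subrKA.
  rewrite xm normrZ exprMn ger0_norm// (distrC w u); lra.
have y_cauchy : cauchy_ex (y n @[n --> \oo]).
  move=> e e0.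
  have e4 : 0 < e ^+ 2 / 4 by rewrite divr_gt0// exprn_gt0.
  have [N _ NP] := near_infty_natSinv_lt (PosNum e4).
  exists (y N), N => // n /= Nn; rewrite -ball_normE /=.
  have := NP N (leqnn N); rewrite /= => Ne.
  have nN : n.+1%:R^-1 <= N.+1%:R^-1 :> R by rewrite lef_pV2 ?posrE// ler_nat.
  have [CN yN] := yP N; have [Cn yn] := yP n.
  have {}yn : `|x - y n| ^+ 2 < D + N.+1%:R^-1.
    by rewrite (lt_le_trans yn)// lerD2l.
  rewrite -ltr_sqr ?nnegrE ?(ltW e0)//.
  apply: lt_le_trans (near_min _ _ _ CN Cn yN yn) _.
  by rewrite mulrC -ler_pdivlMr// ltW.
have [p yp] : exists p : H, y n @[n --> \oo] --> p.
  by apply/cvg_ex; apply: cauchy_cvg; exact: cauchy_exP y_cauchy.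
exists p; split.
  by apply: (closed_cvg C clC _ _ yp); near=> n; have [] := yP n.
move=> z Cz; rewrite -ler_sqr ?nnegrE//; apply: le_trans (D_le _ Cz).
have xyp : `|x - y n| ^+ 2 @[n --> \oo] --> `|x - p| ^+ 2.
  have xy : `|x - y n| @[n --> \oo] --> `|x - p|.
    by apply: cvg_norm; apply: cvgB => //; exact: cvg_cst.
  by under eq_fun do rewrite expr2; rewrite expr2; exact: cvgM.
have DD : D + n.+1%:R^-1 @[n --> \oo] --> D.
  by rewrite -[X in _ --> X]addr0; apply: cvgD; [exact: cvg_cst|exact: cvg_harmonic].
apply: ler_cvg_to xyp DD _; near=> n; apply: ltW.
by have [] := yP n.
Unshelve. all: by end_near. Qed.

(** In [nearest_pointP] and [least_norm_pointP], existence of a minimizer turns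
    the choice operator of the definition into an actual minimizer. *)
Lemma nearest_pointP (C : set H) (x : H) :
  C !=set0 -> closed C -> convex_set C ->
  C (nearest_point C x) /\
  forall y, C y -> `|x - nearest_point C x| <= `|x - y|.
Proof. by move=> C0 clC cC; exact: getPex (projection_exists x C0 clC cC). Qed.

Lemma least_norm_pointP (A : set H) :
  A !=set0 -> closed A -> convex_set A ->
  A (least_norm_point A) /\ forall y, A y -> `|least_norm_point A| <= `|y|.
Proof.
move=> A0 clA cA; apply: (getPex (P := fun p => A p /\ forall y, A y -> `|p| <= `|y|)).
have [p [Ap p_min]] := projection_exists 0 A0 clA cA.
by exists p; split=> // y /p_min; rewrite !sub0r !normrN.
Qed.

End projection_existence.

(** * Alternating projections *)

(** Distances between consecutive terms do not increase, as each term is the best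
    approximation of its predecessor and the term before that is a competitor;
    the telescoping quantity is the squared distance of a n to c2. *)
Lemma alternating_projections_rate (R : realType) (H : normedModType R)
    (dot : {dot H for @idfun R})
    (norm_dot : forall u : H, `|u| = Num.sqrt (dot u u))
    (C1 C2 : set H) (a b : nat -> H) :
  convex_set C1 -> convex_set C2 ->
  (forall n, C1 (b n) /\ forall y, C1 y -> `|a n - b n| <= `|a n - y|) ->
  (forall n, C2 (a n.+1) /\ forall y, C2 y -> `|b n - a n.+1| <= `|b n - y|) ->
  forall c1 c2, C1 c1 -> C2 c2 -> forall n,
  `|a n.+1 - b n| ^+ 2 <= `|c2 - c1| ^+ 2 + `|c2 - a 0%N| ^+ 2 / n.+1%:R.
Proof.
move=> cC1 cC2 bP aP c1 c2 Cc1 Cc2.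
apply: (@telescoping_rate _ _ (fun n => `|c2 - a n| ^+ 2)) => n.
- have [Ca a_min] := aP n; have [Cb b_min] := bP n.
  have [_ b'_min] := bP n.+1; have [_ a'_min] := aP n.+1.
  rewrite ler_sqr ?nnegrE// distrC (le_trans (a'_min _ Ca))//.
  by rewrite distrC b'_min.
- exact: sqr_ge0.
- have [Ca a_min] := aP n; have [Cb b_min] := bP n.
  have := pythagoras_projection norm_dot cC2 Ca a_min Cc2.
  have := four_point norm_dot c2 cC1 Cb b_min Cc1.
  rewrite (distrC (b n)) (distrC (b n)) (distrC (a n.+1) c2); lra.
Qed.

Theorem corollary1p5 (R : realType) (H : completeNormedModType R)
    (dot : {dot H for @idfun R})
    (norm_dot : forall u : H, `|u| = Num.sqrt (dot u u))
    (C1 C2 : set H)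
    (C1_neq0 : C1 !=set0) (C1_closed : closed C1) (C1_convex : convex_set C1)
    (C2_neq0 : C2 !=set0) (C2_closed : closed C2) (C2_convex : convex_set C2)
    (x : nat -> H)
    (x_odd : forall n : nat,
      x (2 * n + 1)%N = nearest_point C1 (x (2 * n)%N))
    (x_even : forall n : nat,
      x (2 * n + 2)%N = nearest_point C2 (x (2 * n + 1)%N)) :
  let v := least_norm_point (closure (minkowski_diff C2 C1)) in
  (x (2 * n + 2)%N - x (2 * n + 1)%N) @[n --> \oo] --> v /\
  (x (2 * n)%N - x (2 * n + 1)%N) @[n --> \oo] --> v.
Proof.
set D := minkowski_diff C2 C1 => v.
have D_convex : convex_set (closure D).
  exact/convex_closure/convex_minkowski_diff.
have D_neq0 : closure D !=set0.
  have [c1 Cc1] := C1_neq0; have [c2 Cc2] := C2_neq0.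
  by exists (c2 - c1); apply: subset_closure; exists c2 => //; exists c1.
have [Dv v_min] := least_norm_pointP norm_dot D_neq0
  (@closed_closure _ D) D_convex.
pose a n := x (2 * n)%N; pose b n := x (2 * n + 1)%N.
have aS n : x (2 * n + 2)%N = a n.+1 by rewrite /a mulnS addnC.
have bP n : C1 (b n) /\ forall y, C1 y -> `|a n - b n| <= `|a n - y|.
  by rewrite /b x_odd; exact: nearest_pointP.
have aP n : C2 (a n.+1) /\ forall y, C2 y -> `|b n - a n.+1| <= `|b n - y|.
  by rewrite -aS x_even; exact: nearest_pointP.
have Dab n m : closure D (a n.+1 - b m).
  apply: subset_closure; exists (a n.+1); first by have [] := aP n.
  by exists (b m); first by have [] := bP m.
have norm_cvg : `|a n.+1 - b n| @[n --> \oo] --> `|v|.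
  apply/cvgrPdist_lt => e e0.
  (* v itself need not be a difference c2 - c1, hence the nearby one; the rate
     for this pair then bounds the gaps by |v| + e from some rank on. *)
  have [_ [c2 Cc2 [c1 Cc1 <-]] vc] := (closure_distP _ _).1 Dv e e0.
  have c_lt : `|c2 - c1| < `|v| + e.
    by have := ler_distD v (c2 - c1) 0; rewrite !subr0 distrC; lra.
  pose K := `|c2 - a 0%N| ^+ 2.
  have rate_cvg : `|c2 - c1| ^+ 2 + K / n.+1%:R @[n --> \oo] -->
      `|c2 - c1| ^+ 2.
    rewrite -[X in _ --> X]addr0 -(mulr0 K).
    apply: cvgD; first exact: cvg_cst.
    by apply: cvgM; [exact: cvg_cst|exact: cvg_harmonic].
  have ve_gt0 : 0 < `|v| + e by rewrite ltr_wpDl.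
  have c_lt2 : `|c2 - c1| ^+ 2 < (`|v| + e) ^+ 2.
    by rewrite ltr_sqr ?nnegrE ?(ltW ve_gt0).
  have : \forall n \near \oo,
      `|c2 - c1| ^+ 2 + K / n.+1%:R < (`|v| + e) ^+ 2.
    exact: cvgr_lt rate_cvg _ c_lt2.
  apply: filterS => n n_lt.
  have := le_lt_trans (alternating_projections_rate norm_dot
    C1_convex C2_convex bP aP Cc1 Cc2 n) n_lt.
  rewrite ltr_sqr ?nnegrE ?(ltW ve_gt0)// => ab_lt.
  by rewrite distrC ger0_norm ?subr_ge0 ?v_min// ltrBlDl.
split.
  under eq_fun do rewrite aS -/(b _).
  by apply: (cvg_least_norm norm_dot D_convex Dv v_min).
(* Shifted by one, because a 0 may lie outside C2. *)
suff : (a n.+1 - b n.+1) @[n --> \oo] --> v.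
  by rewrite (cvg_shiftS (fun n => a n - b n)).
apply: (cvg_least_norm norm_dot D_convex Dv v_min) => //.
apply: squeeze_cvgr norm_cvg; last exact: cvg_cst.
apply: nearW => n; rewrite v_min//=.
by have [_ b_min] := bP n.+1; have [Cb _] := bP n; exact: b_min.
Qed.
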